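(* Let $\mathcal{A}$ be a unital $C^*$-algebra, let $F \in \mathcal{M}\Phi(H_{\mathcal{A}})$ and let $$H_{\mathcal{A}} = M_1 \tilde\oplus N_1 \stackrel{F}{\longrightarrow} M_2 \tilde\oplus N_2 = H_{\mathcal{A}}$$ be a decomposition with respect to which $F$ has the matrix $\begin{bmatrix} F_1 & 0 \\ 0 & F_4\end{bmatrix}$, where $F_1: M_1 \to M_2$ is an isomorphism, $N_2$ is finitely generated and $N_1$ is just closed. Then $N_1$ is finitely generated.
   Context: $\mathcal{A}$ is a unital $C^*$-algebra; $H_{\mathcal{A}} = \ell^2(\mathcal{A})$ is the standard Hilbert $\mathcal{A}$-module, and $B^a(H_{\mathcal{A}})$ is the $C^*$-algebra of bounded adjointable $\mathcal{A}$-linear operators on it. All submodules in decompositions are closed; $M \tilde\oplus N$ denotes a direct sum of closed submodules that is not necessarily orthogonal. A Hilbert module is finitely generated if it is the (algebraic) $\mathcal{A}$-linear span of a finite set. An isomorphism of Hilbert modules is a bounded $\mathcal{A}$-linear bijection (with bounded inverse). That $F$ has a diagonal matrix with entries $F_1, F_4$ with respect to $M_1 \tilde\oplus N_1 \to M_2 \tilde\oplus N_2$ means $F(M_1)\subseteq M_2$, $F(N_1)\subseteq N_2$, $F_1=F|_{M_1}$, $F_4=F|_{N_1}$. $F \in B^a(H_{\mathcal{A}})$ belongs to $\mathcal{M}\Phi(H_{\mathcal{A}})$ ($F$ is $\mathcal{A}$-Fredholm) if there is a decomposition $H_{\mathcal{A}} = M_1 \tilde\oplus N_1 \to M_2 \tilde\oplus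 N_2 = H_{\mathcal{A}}$ into closed submodules with respect to which $F$ is diagonal with $F_1$ an isomorphism and both $N_1, N_2$ finitely generated. *)

(* Defs.v *)
From HB Require Import structures.
From mathcomp Require Import all_boot all_order all_algebra.
From mathcomp Require Import complex ring lra.
From mathcomp Require Import boolp classical_sets functions reals.
From mathcomp Require Import topology normedtype sequences.

Set Implicit Arguments.
Unset Strict Implicit.
Unset Printing Implicit Defensive.
Import Order.TTheory GRing.Theory Num.Theory.
Import numFieldNormedType.Exports.
Local Open Scope classical_set_scope.
Local Open Scope ring_scope.
Local Open Scope complex_scope.

(* A unital C*-algebra: an associative unital complex algebra with a conjugate-linear
   involution and a complete submultiplicative norm satisfying the C*-identity.
   The norm is R-valued and is a field of the mixin because HB cannot join the ring
   and normed-module hierarchies here; the normed-module structure is recovered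
   below as an instance on every C*-algebra. *)
HB.mixin Record isCStarAlgebra (R : realType) A of GRing.Algebra R[i] A := {
  star : A -> A;
  cnorm : A -> R;
  starK : involutive star;
  starD : forall a b, star (a + b) = star a + star b;
  starM : forall a b, star (a * b) = star b * star a;
  starZ : forall (c : R[i]) a, star (c *: a) = conjc c *: star a;
  cnormD : forall a b, cnorm (a + b) <= cnorm a + cnorm b;
  cnormZ : forall (c : R[i]) a, cnorm (c *: a) = Normc.normc c * cnorm a;
  cnorm_eq0 : forall a, cnorm a = 0 -> a = 0;
  cnormM : forall a b, cnorm (a * b) <= cnorm a * cnorm b;
  cnorm_star_mul : forall a, cnorm (star a * a) = cnorm a ^+ 2;
  cnorm_complete : forall u : nat -> A,
    (forall e, 0 < e -> exists n0, forall m n,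
      (n0 <= m)%N -> (n0 <= n)%N -> cnorm (u m - u n) < e) ->
    exists l, forall e, 0 < e -> exists n0, forall n,
      (n0 <= n)%N -> cnorm (l - u n) < e
}.

#[short(type="cstarAlgType")]
HB.structure Definition CStarAlgebra (R : realType) :=
  {A of GRing.Algebra R[i] A & isCStarAlgebra R A}.

Section CStarTheory.
Variables (R : realType) (A : cstarAlgType R).
Implicit Types (a b c g h k u v w : A) (s t : R).
Local Notation N := (@cnorm R A).
Local Notation "t *r a" := ((t%:C : R[i]) *: a) (at level 40).

Lemma cnormZr t a : N (t *r a) = `|t| * N a.
Proof. by rewrite cnormZ /= expr0n addr0 sqrtr_sqr. Qed.
Lemma cnorm0 : N 0 = 0.
Proof. by rewrite -(scale0r (0 : A)) -(rmorph0 (real_complex R)) cnormZr normr0 mul0r. Qed.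
Lemma cnormN a : N (- a) = N a.
Proof. by rewrite -scaleN1r cnormZ /= oppr0 sqrrN expr1n expr0n addr0 sqrtr1 mul1r. Qed.
Lemma cnormBC a b : N (a - b) = N (b - a).
Proof. by rewrite -cnormN opprB. Qed.
Lemma cnorm_ge0 a : 0 <= N a.
Proof. by have := cnormD a (- a); rewrite subrr cnorm0 cnormN; lra. Qed.
Lemma cnormi a : N ('i%C *: a) = N a.
Proof. by rewrite cnormZ /= expr0n add0r expr1n sqrtr1 mul1r. Qed.

Lemma starN a : star (- a) = - star a.
Proof. by rewrite -scaleN1r starZ rmorphN1 scaleN1r. Qed.
Lemma starB a b : star (a - b) = star a - star b.
Proof. by rewrite starD starN. Qed.
Lemma star0 : star (0 : A) = 0.
Proof. by rewrite -[X in star X](subrr 0) starB subrr. Qed.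
Lemma star1 : star (1 : A) = 1.
Proof. by rewrite -[LHS]mul1r -{1}(starK 1) -starM mul1r starK. Qed.
Lemma starZr t a : star (t *r a) = t *r star a.
Proof. by rewrite starZ conjc_real. Qed.
Lemma star_sum (I : Type) (r : seq I) (F : I -> A) :
  star (\sum_(i <- r) F i) = \sum_(i <- r) star (F i).
Proof. exact: (big_morph _ starD star0). Qed.

Lemma cnorm1 : N 1 = 1.
Proof.
have := cnorm_star_mul (1 : A); rewrite star1 mul1r => h.
have [/cnorm_eq0 /eqP|n0] := eqVneq (N 1) 0; first by rewrite oner_eq0.
by apply: (mulfI n0); rewrite mulr1 -expr2 -h.
Qed.
Lemma cnorm_star a : N (star a) = N a.
Proof.
have le b : N b <= N (star b).
  have [->|/eqP n0] := eqVneq (N b) 0; first exact: cnorm_ge0.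
  have p : 0 < N b by rewrite lt_def cnorm_ge0 andbT; apply/eqP.
  rewrite -(ler_pM2r p) -expr2 -cnorm_star_mul; exact: cnormM.
by apply/eqP; rewrite eq_le le andbT -{2}(starK a) le.
Qed.

Lemma scaleC2 a : 2 *r a = a + a.
Proof. by rewrite (_ : 2%:C = 1 + 1) ?scalerDl ?scale1r// -(rmorph1 (real_complex R)) -rmorphD. Qed.
Lemma scaleCA s t a : s *r (t *r a) = (s * t) *r a.
Proof. by rewrite scalerA -rmorphM. Qed.
Lemma scaleC1 a : 1 *r a = a.
Proof. by rewrite rmorph1 scale1r. Qed.

Definition selfadj a := star a = a.

Lemma cnorm_sq a : selfadj a -> N (a * a) = N a ^+ 2.
Proof. by move=> ea; rewrite -cnorm_star_mul ea. Qed.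

Lemma scalerMM (p q : R[i]) a b : (p *: a) * (q *: b) = (p * q) *: (a * b).
Proof. by rewrite -scalerAl -scalerAr scalerA. Qed.

Lemma cnorm_sq2 u w : selfadj u -> selfadj w -> u * w = w * u ->
  N u ^+ 2 <= N (u * u + w * w).
Proof.
move=> hu hw uw; pose z := u + 'i%C *: w.
have sz : star z = u - 'i%C *: w.
  rewrite /z starD starZ hu hw; congr (_ + _).
  by rewrite -scaleNr; congr (_ *: _); apply/eqP; rewrite eq_complex /= oppr0 !eqxx.
have ii : 'i%C * 'i%C = -1 :> R[i] by rewrite -expr2 sqr_i.
have -> : u * u + w * w = star z * z.
  rewrite sz /z mulrDr !mulrBl scalerMM -scalerAl -scalerAr uw ii scaleN1r.
  by rewrite opprK addrA addrNK.
have eu : 2 *r u = z + star z.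
  by rewrite sz /z addrACA subrr addr0 scaleC2.
rewrite cnorm_star_mul lerXn2r ?nnegrE ?cnorm_ge0//.
have := cnormD z (star z); rewrite -eu cnormZr cnorm_star ger0_norm//; lra.
Qed.

Definition tends (x : nat -> A) l := forall e : R, 0 < e ->
  exists n0, forall n, (n0 <= n)%N -> N (l - x n) < e.

Lemma tends_cst a : tends (fun=> a) a.
Proof. by move=> e e0; exists 0%N => n _; rewrite subrr cnorm0. Qed.

Lemma tendsD x y l m : tends x l -> tends y m -> tends (x \+ y) (l + m).
Proof.
move=> xl ym e e0; have e2 : 0 < e / 2 by lra.
have [n1 h1] := xl _ e2; have [n2 h2] := ym _ e2.
exists (maxn n1 n2) => n; rewrite geq_max => /andP[/h1 {}h1 /h2 {}h2] /=.
by rewrite opprD addrACA; have := cnormD (l - x n) (m - y n); lra.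
Qed.

Lemma tends_le (f : A -> A) (C : R) x l : 0 <= C ->
  (forall a b, N (f a - f b) <= C * N (a - b)) -> tends x l -> tends (f \o x) (f l).
Proof.
move=> C0 hf xl e e0.
have [n1 h1] := xl (e / (C + 1)) ltac:(by apply: divr_gt0; lra).
exists n1 => n /h1; rewrite ltr_pdivlMr; last lra.
move=> {}h1; apply: (le_lt_trans (hf _ _)); have := cnorm_ge0 (l - x n); lra.
Qed.

Lemma tendsMl a x l : tends x l -> tends (fun n => a * x n) (a * l).
Proof.
by apply: (@tends_le _ (N a)); rewrite ?cnorm_ge0// => p q; rewrite -mulrBr cnormM.
Qed.
Lemma tendsMr a x l : tends x l -> tends (fun n => x n * a) (l * a).
Proof.
by apply: (@tends_le ( *%R^~ a) (N a)); rewrite ?cnorm_ge0// => p q; rewrite -mulrBl mulrC cnormM.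
Qed.
Lemma tendsZ (p : R[i]) x l : tends x l -> tends (fun n => p *: x n) (p *: l).
Proof.
apply: (@tends_le _ (Normc.normc p)); first by case: p => ? ?; rewrite sqrtr_ge0.
by move=> a b; rewrite -scalerBr cnormZ.
Qed.
Lemma tends_star x l : tends x l -> tends (fun n => star (x n)) (star l).
Proof.
by apply: (@tends_le _ 1) => // p q; rewrite -starB cnorm_star mul1r.
Qed.
Lemma tends_norm x l C : tends x l -> (forall n, N (x n) <= C) -> N l <= C.
Proof.
move=> xl h; apply/ler_addgt0Pr => e e0; have [n1 /(_ n1 (leqnn _)) h1] := xl e e0.
by have := cnormD (l - x n1) (x n1); rewrite subrK; have := h n1; lra.
Qed.
Lemma tends_eq x y l : (x =1 y) -> tends x l -> tends y l.
Proof. by move=> /funext ->. Qed.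
Lemma tends_uniq x l m : tends x l -> tends x m -> l = m.
Proof.
move=> xl xm; apply/eqP; rewrite -subr_eq0; apply/eqP/cnorm_eq0/eqP.
rewrite eq_le cnorm_ge0 andbT; apply: (@tends_norm (fun=> 0)); last by move=> n; rewrite cnorm0.
have := tendsD xl (tendsZ (-1) xm); rewrite scaleN1r; apply: tends_eq => n /=.
by rewrite scaleN1r subrr.
Qed.
Lemma tendsS x l : tends x l -> tends (fun n => x n.+1) l.
Proof.
move=> xl e /xl[n1 h1]; exists n1 => n hn; apply: h1; exact: leqW.
Qed.
Lemma tendsM x y l m C : (forall n, N (x n) <= C) ->
  tends x l -> tends y m -> tends (fun n => x n * y n) (l * m).
Proof.
move=> bx xl ym.
have C0 : 0 <= C by apply: le_trans (bx 0%N); exact: cnorm_ge0.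
have d : tends (fun n => x n * (y n - m)) 0.
  have z := tendsD ym (tends_cst (- m)); rewrite subrr in z.
  move=> e e0; have [n1 h1] := z (e / (C + 1)) ltac:(by apply: divr_gt0; lra).
  exists n1 => n /h1 /=; rewrite !sub0r !cnormN ltr_pdivlMr; last lra.
  move=> {}h1; apply: (le_lt_trans (cnormM _ _)).
  have := bx n; have := cnorm_ge0 (y n - m); have := cnorm_ge0 (x n); nra.
have := tendsD d (tendsMr m xl); rewrite add0r; apply: tends_eq => n /=.
by rewrite mulrBr subrK.
Qed.

(* y_(n+1) = (g + y_n^2) / 2 converges to 1 - sqrt (1 - g); its increments are
   dominated by those of the same recursion for the scalar g = 1. *)
Fixpoint ysqrt g n := if n is m.+1 then 2^-1 *r (g + ysqrt g m * ysqrt g m) else 0.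
Fixpoint ydom n : R := if n is m.+1 then (1 + ydom m ^+ 2) / 2 else 0.

Lemma ydom01 n : 0 <= ydom n <= 1.
Proof. by elim: n => [|n /andP[h1 h2]] /=; [lra | apply/andP; split; nra]. Qed.
Lemma ydomE n : ydom n.+1 = (1 + ydom n ^+ 2) / 2.
Proof. by []. Qed.
Lemma ydomS n : ydom n <= ydom n.+1.
Proof. by have := ydom01 n; rewrite /=; nra. Qed.

Lemma ysqrt_comm g b n : b * g = g * b -> b * ysqrt g n = ysqrt g n * b.
Proof.
move=> h; elim: n => [|n IH] /=; first by rewrite mulr0 mul0r.
rewrite -scalerAl -scalerAr mulrDr mulrDl h; congr (_ *: (_ + _)).
by rewrite mulrA IH -mulrA IH mulrA.
Qed.
Lemma ysqrt_sa g n : selfadj g -> selfadj (ysqrt g n).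
Proof.
move=> h; elim: n => [|n IH]; rewrite /selfadj /=; first exact: star0.
by rewrite starZr starD starM IH h.
Qed.
Lemma ysqrt_le g n : N g <= 1 -> N (ysqrt g n) <= ydom n.
Proof.
move=> h; elim: n => [|n IH] /=; first by rewrite cnorm0.
rewrite cnormZr ger0_norm; last lra.
have := cnormD g (ysqrt g n * ysqrt g n); have := cnormM (ysqrt g n) (ysqrt g n).
have := cnorm_ge0 (ysqrt g n); nra.
Qed.
Lemma ysqrt_step g n : N g <= 1 ->
  N (ysqrt g n.+1 - ysqrt g n) <= ydom n.+1 - ydom n.
Proof.
move=> h; elim: n => [|n IH].
  rewrite /= mul0r addr0 !subr0 cnormZr expr0n addr0 ger0_norm; lra.
have -> : ysqrt g n.+2 - ysqrt g n.+1 =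
    2^-1 *r ((ysqrt g n.+1 - ysqrt g n) * (ysqrt g n.+1 + ysqrt g n)).
  have c : ysqrt g n.+1 * ysqrt g n = ysqrt g n * ysqrt g n.+1.
    by apply: ysqrt_comm; apply/esym/ysqrt_comm.
  rewrite [ysqrt g n.+2]/= -/(ysqrt g n.+1) {2}/ysqrt -/(ysqrt g n) -scalerBr.
  congr (_ *: _); rewrite opprD addrACA subrr add0r.
  by rewrite mulrDr !mulrBl c addrA subrK.
rewrite cnormZr ger0_norm; last lra.
have hp := cnormM (ysqrt g n.+1 - ysqrt g n) (ysqrt g n.+1 + ysqrt g n).
have hs := cnormD (ysqrt g n.+1) (ysqrt g n).
have h1 := ysqrt_le n.+1 h; have h0 := ysqrt_le n h.
have -> : ydom n.+2 - ydom n.+1 = 2^-1 * ((ydom n.+1 - ydom n) * (ydom n.+1 + ydom n)).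
  rewrite [ydom n.+2](ydomE n.+1) [X in _ - X = _](ydomE n); ring.
rewrite ler_pM2l; last lra.
apply: (le_trans hp); apply: ler_pM; rewrite ?cnorm_ge0//.
by apply: (le_trans hs); apply: lerD.
Qed.
Lemma ysqrt_dist g m n : N g <= 1 -> (n <= m)%N ->
  N (ysqrt g m - ysqrt g n) <= ydom m - ydom n.
Proof.
move=> h /subnK <-; elim: (m - n)%N => [|d IH]; first by rewrite !subrr cnorm0.
rewrite addSn.
have := ysqrt_step (d + n) h; have := cnormD (ysqrt g (d + n).+1 - ysqrt g (d + n)) (ysqrt g (d + n) - ysqrt g n).
rewrite addrA subrK; lra.
Qed.
Lemma ydom_cauchy (e : R) : 0 < e ->
  exists n0, forall m n, (n0 <= n)%N -> (n <= m)%N -> ydom m - ydom n < e.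
Proof.
move=> e0.
have nd : nondecreasing_seq ydom by apply/nondecreasing_seqP; exact: ydomS.
have bd : has_ubound (range ydom).
  by exists 1 => _ [n _ <-]; have /andP[] := ydom01 n.
have cv : cvgn ydom by apply: nondecreasing_is_cvgn.
have /cvgrPdist_lt /(_ e e0) [n0 _ h] := cv.
exists n0 => m n h1 h2.
have := h n h1; have := nondecreasing_cvgn_le nd cv m; have := nondecreasing_cvgn_le nd cv n.
move=> p q r; have := ler_norm (lim (ydom @ \oo) - ydom n); lra.
Qed.

Lemma sqrt_one g : selfadj g -> N g <= 1 -> exists v,
  [/\ selfadj v, v * v = 1 - g, forall b, b * g = g * b -> b * v = v * b & N (1 - v) <= 1].
Proof.
move=> sg g1.
have [y hy] : exists l, tends (ysqrt g) l.
  apply: cnorm_complete => e /ydom_cauchy [n0 h]; exists n0 => m n hm hn.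
  have [nm|mn] := leqP n m.
    exact: le_lt_trans (ysqrt_dist g1 nm) (h _ _ hn nm).
  rewrite cnormBC.
  exact: le_lt_trans (ysqrt_dist g1 (ltnW mn)) (h _ _ hm (ltnW mn)).
have b1 n : N (ysqrt g n) <= 1.
  by apply: le_trans (ysqrt_le n g1) _; have /andP[] := ydom01 n.
have sy : selfadj y.
  apply: (tends_uniq (tends_star hy)); apply: tends_eq hy => n.
  by rewrite ysqrt_sa.
have ey : y = 2^-1 *r (g + y * y).
  apply: (tends_uniq (tendsS hy)).
  exact: (tendsZ _ (tendsD (tends_cst g) (tendsM b1 hy hy))).
have cy b : b * g = g * b -> b * y = y * b.
  move=> h; apply: (tends_uniq (tendsMl b hy)); apply: tends_eq (tendsMr b hy) => n.
  by rewrite ysqrt_comm.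
exists (1 - y); split.
- by rewrite /selfadj starB star1 sy.
- have e2 : g + y * y = y + y.
    have : 2 *r y = 2 *r (2^-1 *r (g + y * y)) by rewrite -ey.
    by rewrite scaleCA divff ?pnatr_eq0// scaleC1 scaleC2.
  rewrite mulrBr mulr1 mulrBl mul1r (_ : g = y + y - y * y); last by rewrite -e2 addrK.
  by rewrite !opprB !opprD !addrA [1 - y + _]addrAC.
- by move=> b /cy h; rewrite mulrBr mulrBl h mulr1 mul1r.
- by rewrite opprB addrCA subrr addr0; exact: tends_norm hy b1.
Qed.
End CStarTheory.

Section Positive.
Variables (R : realType) (A : cstarAlgType R).
Implicit Types (a b c g h k u v w p q x y : A) (s t : R).
Local Notation N := (@cnorm R A).
Local Notation "t *r a" := ((t%:C : R[i]) *: a) (at level 40).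

(* Squares of self-adjoint elements; pos_star_mul shows that every star a * a
   is of this form. *)
Definition cpos h := exists k, selfadj k /\ h = k * k.

Lemma sa_scale t a : selfadj a -> selfadj (t *r a).
Proof. by rewrite /selfadj starZr => ->. Qed.
Lemma saD a b : selfadj a -> selfadj b -> selfadj (a + b).
Proof. by rewrite /selfadj starD => -> ->. Qed.
Lemma saB a b : selfadj a -> selfadj b -> selfadj (a - b).
Proof. by rewrite /selfadj starB => -> ->. Qed.
Lemma saM a b : selfadj a -> selfadj b -> a * b = b * a -> selfadj (a * b).
Proof. by rewrite /selfadj starM => -> ->. Qed.
Lemma sa1 : selfadj (1 : A). Proof. exact: star1. Qed.
Lemma sa0 : selfadj (0 : A). Proof. exact: star0. Qed.
Lemma sa_star_mul a : selfadj (star a * a).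
Proof. by rewrite /selfadj starM starK. Qed.
Lemma rscaleMM s t a b : (s *r a) * (t *r b) = (s * t) *r (a * b).
Proof. by rewrite scalerMM -rmorphM. Qed.

Lemma sqrtMM t : 0 <= t -> Num.sqrt t * Num.sqrt t = t.
Proof. by move=> t0; rewrite -expr2 sqr_sqrtr. Qed.
Lemma pos_sa h : cpos h -> selfadj h.
Proof. by move=> [k [sk ->]]; apply: saM. Qed.
Lemma pos_sq k : selfadj k -> cpos (k * k).
Proof. by exists k. Qed.
Lemma pos_star_sa k : selfadj k -> cpos (star k * k).
Proof. by move=> sk; exists k; rewrite sk. Qed.
Lemma posZ t h : 0 <= t -> cpos h -> cpos (t *r h).
Proof.
move=> t0 [k [sk ->]]; exists (Num.sqrt t *r k); split; first exact: sa_scale.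
by rewrite rscaleMM sqrtMM.
Qed.

Lemma posI t h : selfadj h -> 0 <= t -> N (t *r 1 - h) <= t -> exists e,
  [/\ selfadj e, e * e = h, forall b, b * h = h * b -> b * e = e * b &
      N (Num.sqrt t *r 1 - e) <= Num.sqrt t].
Proof.
move=> sh t0 ht.
have [t00|tn0] := eqVneq t 0.
  have h0 : h = 0.
    apply/cnorm_eq0/eqP; rewrite eq_le cnorm_ge0 andbT.
    by move: ht; rewrite t00 rmorph0 scale0r sub0r cnormN.
  exists 0; rewrite t00 sqrtr0 rmorph0 scale0r subrr cnorm0 h0 mul0r; split => //.
  exact: sa0.
have tp : 0 < t by rewrite lt_def tn0.
pose r := Num.sqrt t; have rr : r * r = t by rewrite sqrtMM.
have r0 : 0 <= r by exact: sqrtr_ge0.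
pose g := 1 - t^-1 *r h.
have eg : g = t^-1 *r (t *r 1 - h) by rewrite scalerBr scaleCA mulVf// scaleC1.
have [||v [sv vv cv nv]] := @sqrt_one R A g.
- by apply: saB; [exact: sa1|exact: sa_scale].
- rewrite eg cnormZr ger0_norm ?invr_ge0// mulrC ler_pdivrMr// mul1r//.
exists (r *r v); split.
- exact: sa_scale.
- by rewrite rscaleMM rr vv /g opprB addrC subrK scaleCA divff// scaleC1.
- move=> b bh; rewrite -scalerAl -scalerAr; congr (_ *: _); apply: cv.
  by rewrite /g mulrBr mulrBl mulr1 mul1r -scalerAl -scalerAr bh.
- rewrite -scalerBr cnormZr ger0_norm// -[leRHS]mulr1; exact: ler_wpM2l.
Qed.

Lemma posE k t : selfadj k -> N k ^+ 2 <= t -> N (t *r 1 - k * k) <= t.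
Proof.
move=> sk kt; have t0 : 0 <= t by apply: le_trans kt; exact: sqr_ge0.
have [t00|tn0] := eqVneq t 0.
  have -> : k = 0.
    apply: cnorm_eq0; apply/eqP; rewrite -sqrf_eq0 eq_le sqr_ge0 andbT.
    by move: kt; rewrite t00.
  by rewrite mul0r subr0 t00 rmorph0 scale0r cnorm0.
have tp : 0 < t by rewrite lt_def tn0.
pose r := Num.sqrt t; have rr : r * r = t by rewrite sqrtMM.
have r0 : 0 < r by rewrite sqrtr_gt0.
pose u := r^-1 *r k; have su : selfadj u by exact: sa_scale.
have uu : u * u = t^-1 *r (k * k) by rewrite rscaleMM -invfM rr.
have [||v [sv vv cv nv]] := @sqrt_one R A (u * u).
- exact: saM.
- rewrite uu cnormZr cnorm_sq// ger0_norm ?invr_ge0// mulrC ler_pdivrMr// mul1r//.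
have uv : v * u = u * v by apply/esym/cv; rewrite mulrA.
have := cnorm_sq2 sv su uv; rewrite vv subrK cnorm1 -cnorm_sq// vv => h.
have -> : t *r 1 - k * k = t *r (1 - u * u).
  by rewrite uu scalerBr scaleCA divff// scaleC1.
rewrite cnormZr ger0_norm//; nra.
Qed.

Lemma pos_sqrt h : cpos h -> exists e,
  [/\ cpos e, e * e = h & forall b, b * h = h * b -> b * e = e * b].
Proof.
move=> [k [sk eh]]; have := posE sk (lexx _); rewrite -eh => hn.
have [|e [se ee ce ne]] := posI _ (sqr_ge0 _) hn; first by rewrite eh; exact: saM.
exists e; split=> //.
by have [f [sf ff _ _]] := posI se (sqrtr_ge0 _) ne; exists f.
Qed.

Lemma posD h k : cpos h -> cpos k -> cpos (h + k).
Proof.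
move=> ph pk; have sh := pos_sa ph; have sk := pos_sa pk.
move: ph pk => [u [su eu]] [v [sv ev]].
have [|||e [se ee _ _]] := @posI (N u ^+ 2 + N v ^+ 2) (h + k).
- exact: saD.
- by rewrite addr_ge0 ?sqr_ge0.
- rewrite rmorphD scalerDl opprD addrACA.
  apply: (le_trans (cnormD _ _)); rewrite eu ev.
  by apply: lerD; exact: posE.
by exists e.
Qed.

Lemma kaplansky c k : selfadj k -> star c * c = - (k * k) -> c = 0.
Proof.
have half (a : A) : a = 2^-1 *r (a + a).
  by rewrite -scaleC2 scaleCA mulVf ?pnatr_eq0// scaleC1.
have main d l : selfadj l -> N d = 1 -> star d * d = - (l * l) -> False.
  move=> sl d1 dd.
  have pp : cpos (d * star d).
    pose p1 := d + star d; pose p2 := 'i%C *: (d - star d).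
    have s1 : selfadj p1 by rewrite /selfadj /p1 starD starK addrC.
    have s2 : selfadj p2.
      rewrite /selfadj /p2 starZ starB starK -opprB scalerN -scaleNr.
      by congr (_ *: _); apply/eqP; rewrite eq_complex /= oppr0 opprK !eqxx.
    have e : p1 * p1 + p2 * p2 = 2 *r (d * star d + star d * d).
      have ii : 'i%C * 'i%C = -1 :> R[i] by rewrite -expr2 sqr_i.
      pose X := d * d + star d * star d; pose Y := d * star d + star d * d.
      have -> : p1 * p1 = X + Y.
        by rewrite /p1 mulrDl !mulrDr (addrC (star d * d)) addrACA.
      have -> : p2 * p2 = Y - X.
        rewrite /p2 scalerMM ii scaleN1r mulrBl !mulrBr.
        by rewrite (opprB (star d * d)) addrACA -opprD opprB.
      by rewrite addrC addrA subrK scaleC2.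
    have -> : d * star d = l * l + 2^-1 *r (p1 * p1 + p2 * p2).
      by rewrite e scaleCA mulVf ?pnatr_eq0// scaleC1 dd addrCA subrr addr0.
    apply: posD; first exact: pos_sq.
    apply: posZ; first by rewrite invr_ge0.
    by apply: posD; exact: pos_sq.
  have [r [sr er]] := pp.
  have nr : N r ^+ 2 = 1.
    by rewrite -cnorm_sq// -er -{1}(starK d) cnorm_star_mul cnorm_star d1 expr1n.
  have n1 : N (1 - d * star d) <= 1.
    by rewrite er -[X in X - _]scaleC1; apply: posE => //; rewrite nr.
  have [q eq] : exists q, q = l * l by exists (l * l).
  have nq : N q = 1 by rewrite eq -cnormN -dd cnorm_star_mul d1 expr1n.
  have sq : selfadj q by rewrite eq; exact: saM.
  have e : star d * (1 - d * star d) * d = - (q + q * q).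
    rewrite mulrBr mulr1 mulrBl !mulrA dd -(mulrA _ (star d)) dd -eq.
    by rewrite mulrN mulNr opprK opprD.
  have n2 : N (q + q * q) <= 1.
    rewrite -cnormN -e; apply: (le_trans (cnormM _ _)); rewrite d1 mulr1.
    apply: (le_trans (cnormM _ _)); rewrite cnorm_star d1 mul1r//.
  have [|v [sv vv cv _]] := sqrt_one sq; first by rewrite nq.
  have lv : l * v = v * l by apply: cv; rewrite eq mulrA.
  pose u := Num.sqrt 2 *r q; pose w := l * v.
  have su : selfadj u by exact: sa_scale.
  have sw : selfadj w by apply: saM.
  have uw : u * w = w * u.
    rewrite /u /w -scalerAl -scalerAr; congr (_ *: _).
    by rewrite -mulrA -(cv q)// eq !mulrA.
  have := cnorm_sq2 su sw uw.
  have -> : u * u + w * w = q + q * q.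
    rewrite /u rscaleMM sqrtMM// scaleC2 /w.
    rewrite (_ : l * v * (l * v) = q - q * q).
      by rewrite addrC addrA subrK.
    by rewrite {2}lv mulrA -(mulrA l) vv mulrBr mulr1 mulrBl eq !mulrA.
  rewrite cnormZr nq mulr1 ger0_norm ?sqrtr_ge0// sqr_sqrtr//; lra.
move=> sk cc.
have [/cnorm_eq0//|n0] := eqVneq (N c) 0.
case: (@main ((N c)^-1 *r c) ((N c)^-1 *r k)).
- exact: sa_scale.
- by rewrite cnormZr ger0_norm ?invr_ge0 ?cnorm_ge0// mulVf.
- by rewrite starZr !rscaleMM cc scalerN.
Qed.

Lemma pos_star_mul a : cpos (star a * a).
Proof.
set h := star a * a; have sh : selfadj h by exact: sa_star_mul.
have [d [pd dd cd]] := pos_sqrt (pos_sq sh).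
have sd := pos_sa pd.
have hd : h * d = d * h by apply: cd; rewrite mulrA.
have [e [pe ee ce]] := pos_sqrt pd.
have se := pos_sa pe.
pose n := d - h.
have sn : selfadj n by exact: saB.
have hn : h * n = - (d * n) by rewrite !mulrBr hd dd opprB.
have nn : n * n = 2 *r (d * n) by rewrite {1}/n mulrBl hn opprK scaleC2.
have nd : n * d = d * n by rewrite mulrBr mulrBl hd.
have en : n * e = e * n by apply: ce.
have sk : selfadj (e * n) by apply: saM.
have kk : e * n * (e * n) = n * (d * n) by rewrite -{1}en -ee !mulrA.
have c0 : a * n = 0.
  apply: (kaplansky sk); rewrite starM sn kk -!mulrA [star a * _]mulrA -/h hn mulrN//.
have n3 : n * (d * n) = 0.
  rewrite -[LHS]opprK -mulrN -hn /h -(mulrA (star a)) c0 !mulr0 oppr0//.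
have n4 : n * n * (n * n) = 0.
  by rewrite -mulrA nn -!scalerAr n3 mulr0 scaler0.
have n0 : n = 0.
  apply/cnorm_eq0/eqP; have := cnorm0 A; rewrite -n4 cnorm_sq; last exact: saM.
  by rewrite cnorm_sq// => /eqP; rewrite !sqrf_eq0.
by have /eqP := n0; rewrite subr_eq0 => /eqP <-.
Qed.

Lemma pos_conj b p : cpos p -> cpos (star b * p * b).
Proof.
move=> [k [sk ->]]; have := pos_star_mul (k * b).
by rewrite starM sk !mulrA.
Qed.
Lemma pos_cnorm p : cpos p -> cpos (N p *r 1 - p).
Proof.
move=> pp; have [k [sk ek]] := pp.
have [|||e [se <- _ _]] := @posI (N p) (N p *r 1 - p); last exact: pos_sq.
- by apply: saB; [apply/sa_scale/sa1|exact: pos_sa].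
- exact: cnorm_ge0.
- by rewrite opprB addrCA subrr addr0.
Qed.
Lemma cnorm_le_scale p t : 0 <= t -> cpos p -> cpos (t *r 1 - p) -> N p <= t.
Proof.
move=> t0 [k [sk ek]] /pos_sqrt[w [pw ww cw]].
have kw : k * w = w * k.
  by apply: cw; rewrite ek mulrBr mulrBl -scalerAl -scalerAr mulr1 mul1r mulrA.
have := cnorm_sq2 sk (pos_sa pw) kw; rewrite -cnorm_sq// -ek ww addrCA subrr addr0.
by rewrite cnormZr cnorm1 mulr1 ger0_norm.
Qed.
Lemma cnorm_mono p q : cpos p -> cpos q -> N p <= N (p + q).
Proof.
move=> pp pq; apply: cnorm_le_scale => //; first exact: cnorm_ge0.
have -> : N (p + q) *r 1 - p = (N (p + q) *r 1 - (p + q)) + q.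
  by rewrite opprD addrA subrK.
by apply: posD => //; apply/pos_cnorm/posD.
Qed.
Lemma pos0 : cpos 0. Proof. by exists 0; rewrite mul0r; split=> //; exact: sa0. Qed.
Lemma pos_sum (I : Type) (r : seq I) (F : I -> A) :
  (forall i, cpos (F i)) -> cpos (\sum_(i <- r) F i).
Proof. by move=> h; elim/big_ind: _ => //; [exact: pos0|exact: posD]. Qed.
End Positive.

Section NormedCStar.
Variables (R : realType) (A : cstarAlgType R).
Local Notation N := (@cnorm R A).
(* The library's normed-module structure (hence topology, cvgn, limn) on the
   C*-algebra is the one given by cnorm; see cstar_normE. *)
Let nrm (a : A) : R[i] := (N a)%:C.
Lemma nrmD a b : nrm (a + b) <= nrm a + nrm b.
Proof. by rewrite -rmorphD lecR cnormD. Qed.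
Lemma nrmZ (c : R[i]) a : nrm (c *: a) = `|c| * nrm a.
Proof. by rewrite /nrm cnormZ rmorphM; congr (_ * _); rewrite normc_def; case: c. Qed.
Lemma nrm_eq0 a : nrm a = 0 -> a = 0.
Proof. by move=> [/cnorm_eq0]. Qed.
HB.instance Definition _ := Lmodule_isNormed.Build R[i] (CStarAlgebra.sort A) nrmD nrmZ nrm_eq0.
End NormedCStar.


Section Convergence.
Variables (R : realType) (A : cstarAlgType R).
Implicit Types (a b : A) (x y z : nat -> A) (r : seq nat).
Local Notation N := (@cnorm R A).
Local Notation "t *r a" := ((t%:C : R[i]) *: a) (at level 40).

Lemma cstar_normE a : `|a| = (N a)%:C.
Proof. by []. Qed.

Lemma tendsP (u : nat -> A) l : u @ \oo --> l <-> tends u l.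
Proof.
split=> [/cvgrPdist_lt h e e0|h].
  have [|n0 _ hn] := h e%:C; first by rewrite ltcR.
  by exists n0 => n /hn; rewrite cstar_normE ltcR.
apply/cvgrPdist_lt => e e0; have er : e = (complex.Re e)%:C.
  by rewrite RRe_real// gtr0_real.
have [|n0 hn] := h (complex.Re e); first by rewrite -ltcR -er.
by exists n0 => // n /= /hn; rewrite cstar_normE -ltcR -er.
Qed.

Lemma series_cauchy (u : nat -> A) : cvgn (series u) <->
  (forall e : R, 0 < e -> exists n0, forall m n, (n0 <= n)%N -> (n <= m)%N ->
    N (\sum_(n <= k < m) u k) < e).
Proof.
split=> [/cvg_ex[/= l /tendsP h] e e0|h].
  have [|n0 hn] := h (e / 2); first lra.
  exists n0 => m n h1 h2; rewrite -sub_series_geq//.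
  have := hn _ h1; have := hn _ (leq_trans h1 h2).
  have := cnormD (series u m - l) (l - series u n).
  by rewrite addrA subrK (cnormBC _ l); lra.
have [|l hl] := @cnorm_complete R A (series u).
  move=> e /h[n0 hn]; exists n0 => m n hm hn'.
  have [nm|/ltnW mn] := leqP n m; first by rewrite sub_series_geq//; exact: hn.
  by rewrite cnormBC sub_series_geq//; exact: hn.
by apply/cvg_ex; exists l; apply/tendsP.
Qed.

Let S r x y := \sum_(i <- r) star (x i) * y i.

Lemma cs_sum r x y : N (S r x y) ^+ 2 <= N (S r x x) * N (S r y y).
Proof.
have pS z : cpos (S r z z) by apply: pos_sum => i; exact: pos_star_mul.
have main t : 0 < t -> N (S r x x) <= t -> N (S r x y) ^+ 2 <= t * N (S r y y).
  move=> t0 ht; have tn : t != 0 by rewrite gt_eqF.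
  have [a sxy] : exists a, S r x y = t *r a.
    by exists (t^-1 *r S r x y); rewrite scaleCA divff// scaleC1.
  pose z i := x i * a - y i.
  have ez : S r z z = star a * S r x x * a - star a * S r x y - star (S r x y) * a + S r y y.
    rewrite /S star_sum !(mulr_sumr, mulr_suml) -!sumrB -big_split /=.
    apply: eq_bigr => i _; rewrite /z starB !starM starK mulrBl !mulrBr !mulrA.
    by rewrite opprB !addrA (addrAC _ (_ * y i)).
  have ey : S r y y = t *r (star a * a) + (S r z z + star a * (t *r 1 - S r x x) * a).
    have -> : star a * (t *r 1 - S r x x) * a = t *r (star a * a) - star a * S r x x * a.
      by rewrite mulrBr mulrBl -scalerAr mulr1 -scalerAl.
    rewrite ez sxy starZr -scalerAl -scalerAr [in RHS]addrAC [_ + (_ - _)]addrA.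
    by rewrite subrK [_ - _ - _]addrAC subrr add0r addrA subrr add0r.
  have pt : cpos (t *r 1 - S r x x).
    have -> : t *r 1 - S r x x = (t - N (S r x x)) *r 1 + (N (S r x x) *r 1 - S r x x).
      by rewrite rmorphB scalerBl addrA subrK.
    apply: posD; last exact: pos_cnorm.
    by apply: posZ; [rewrite subr_ge0|rewrite -(mulr1 1); apply/pos_sq/sa1].
  have h : N (t *r (star a * a)) <= N (S r y y).
    rewrite ey; apply: cnorm_mono; first by apply: posZ; [exact: ltW|exact: pos_star_mul].
    by apply: posD => //; exact: pos_conj.
  rewrite sxy cnormZr exprMn -cnorm_star_mul expr2 -mulrA -cnormZr ger0_norm ?(ltW t0)//.
  by rewrite ler_pM2l.
have := cnorm_ge0 (S r x x); rewrite le_eqVlt => /predU1P[h0|h0]; last exact: main.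
rewrite -h0 mul0r; apply/ler_addgt0Pr => e e0; rewrite add0r.
have p : 0 < N (S r y y) + 1 by have := cnorm_ge0 (S r y y); lra.
have t0 : 0 < e / (N (S r y y) + 1) by exact: divr_gt0.
apply: le_trans (main _ t0 _) _; first by rewrite -h0 ltW.
rewrite mulrAC ler_pdivrMr// ler_pM2l//; lra.
Qed.

Definition l2_pred : pred (nat -> A) :=
  fun x => `[< cvgn (series (fun n => star (x n) * x n)) >].

Lemma l2_cvg x y : x \in l2_pred -> y \in l2_pred ->
  cvgn (series (fun n => star (x n) * y n)).
Proof.
move=> /asboolP/series_cauchy hx /asboolP/series_cauchy hy.
apply/series_cauchy => e e0; have [n1 h1] := hx e e0; have [n2 h2] := hy e e0.
exists (maxn n1 n2) => m n; rewrite geq_max => /andP[/h1 {}h1 /h2 {}h2] nm.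
have {}h1 := h1 _ nm; have {}h2 := h2 _ nm.
have := cs_sum (index_iota n m) x y; rewrite /S.
move: (cnorm_ge0 (\sum_(n <= k < m) star (x k) * y k)).
move: (cnorm_ge0 (\sum_(n <= k < m) star (x k) * x k)) h1.
move: (cnorm_ge0 (\sum_(n <= k < m) star (y k) * y k)) h2.
move=> p2 q2 p1 q1 p0 h; rewrite ltNge; apply/negP => h3; nra.
Qed.

Lemma l2_subsemimod_closed : GRing.subsemimod_closed l2_pred.
Proof.
split; first split.
- apply/asboolP/series_cauchy => e e0; exists 0%N => m n _ _.
  by rewrite big1 ?cnorm0// => i _; rewrite mulr0.
- move=> x y hx hy; apply/asboolP.
  rewrite (_ : (fun _ => _) = (fun n => star (x n) * x n) + (fun n => star (x n) * y n)
    + ((fun n => star (y n) * x n) + (fun n => star (y n) * y n))); last first.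
    by apply/funext => n; rewrite /= starD mulrDl !mulrDr.
  by rewrite !seriesD; apply: is_cvgD; apply: is_cvgD; exact: l2_cvg.
- move=> c x hx; apply/asboolP.
  rewrite (_ : (fun _ => _) = (conjc c * c) *: (fun n => star (x n) * x n)).
    rewrite seriesZ; have /cvg_ex[/= l /tendsP hl] := l2_cvg hx hx.
    by apply/cvg_ex; exists (conjc c * c *: l); apply/tendsP; exact: tendsZ.
  by apply/funext => n; rewrite /= starZ scalerMM.
Qed.

HB.instance Definition _ :=
  GRing.isSubmodClosed.Build R[i] (nat -> A) l2_pred l2_subsemimod_closed.

Lemma l2_pred_mulr x a : x \in l2_pred -> (fun n => x n * a) \in l2_pred.
Proof.
move=> hx; apply/asboolP; have /cvg_ex[/= l /tendsP hl] := l2_cvg hx hx.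
apply/cvg_ex; exists (star a * l * a); apply/tendsP.
apply: tends_eq (tendsMr a (tendsMl (star a) hl)) => n /=.
by rewrite mulr_sumr mulr_suml; apply: eq_bigr => i _; rewrite starM !mulrA.
Qed.

End Convergence.

Section StandardModule.
Variables (R : realType) (A : cstarAlgType R).

Record l2 := L2 { l2_val :> nat -> A; l2_valP : l2_val \in @l2_pred R A }.

HB.instance Definition _ := [isSub for l2_val].
HB.instance Definition _ := [Choice of l2 by <:].
HB.instance Definition _ := [SubChoice_isSubLmodule of l2 by <:].

(* Right module: (x . a)_n = x_n a, and the inner product below is
   conjugate-linear in its first argument. *)
Definition ract (x : l2) (a : A) : l2 := L2 (l2_pred_mulr a (l2_valP x)).

Definition inner (x y : l2) : A := limn (series (fun n => star (x n) * y n)).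

Definition l2norm (x : l2) : R := Num.sqrt (cnorm (inner x x)).
End StandardModule.

Section NormedL2.
Variables (R : realType) (A : cstarAlgType R).
Implicit Types (x y z : l2 A) (a : A).
Local Notation N := (@cnorm R A).
Local Notation S x y n := (\sum_(0 <= i < n) star (x i) * y i).

Lemma inner_tends x y : tends (fun n => S x y n) (inner x y).
Proof. by apply/tendsP; exact: (l2_cvg (l2_valP x) (l2_valP y)). Qed.

Lemma innerDr x y z : inner x (y + z) = inner x y + inner x z.
Proof.
apply: (tends_uniq (inner_tends _ _)).
apply: tends_eq (tendsD (inner_tends x y) (inner_tends x z)) => n /=.
by rewrite -big_split; apply: eq_bigr => i _; rewrite /= -mulrDr.
Qed.
Lemma inner_star x y : star (inner x y) = inner y x.
Proof.
apply: tends_uniq (inner_tends y x).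
apply: tends_eq (tends_star (inner_tends x y)) => n /=.
by rewrite star_sum; apply: eq_bigr => i _; rewrite starM starK.
Qed.
Lemma innerDl x y z : inner (x + y) z = inner x z + inner y z.
Proof. by rewrite -!(inner_star z) innerDr starD. Qed.
Lemma innerZr (c : R[i]) x y : inner x (c *: y) = c *: inner x y.
Proof.
apply: (tends_uniq (inner_tends _ _)).
apply: tends_eq (tendsZ c (inner_tends x y)) => n /=.
by rewrite scaler_sumr; apply: eq_bigr => i _; rewrite /= -scalerAr.
Qed.

Lemma partial_le x n : N (S x x n) <= N (inner x x).
Proof.
apply/ler_addgt0Pr => e e0; have [m0 h] := inner_tends x x e0.
have := h _ (leq_maxl m0 n).
have : N (S x x n) <= N (S x x (maxn m0 n)).
  rewrite [leRHS](_ : _ = N (S x x n + \sum_(n <= i < maxn m0 n) star (x i) * x i)).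
    by apply: cnorm_mono; apply: pos_sum => i; exact: pos_star_mul.
  by rewrite -big_cat_nat// leq_maxr.
have := cnormD (S x x (maxn m0 n) - inner x x) (inner x x).
rewrite subrK cnormBC; lra.
Qed.

Lemma inner_cs x y : N (inner x y) <= l2norm x * l2norm y.
Proof.
apply: (tends_norm (inner_tends x y)) => n.
rewrite -sqrtrM ?cnorm_ge0// -(@ler_pXn2r _ 2) ?nnegrE ?cnorm_ge0 ?sqrtr_ge0//.
rewrite sqr_sqrtr ?mulr_ge0 ?cnorm_ge0//; apply: (le_trans (cs_sum _ _ _)).
by apply: ler_pM; rewrite ?cnorm_ge0 ?partial_le.
Qed.

Lemma l2norm_sq x : l2norm x ^+ 2 = N (inner x x).
Proof. by rewrite sqr_sqrtr// cnorm_ge0. Qed.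

Let nrm x : R[i] := (l2norm x)%:C.
Lemma l2normD x y : nrm (x + y) <= nrm x + nrm y.
Proof.
rewrite -rmorphD lecR -(@ler_pXn2r _ 2) ?nnegrE ?addr_ge0 ?sqrtr_ge0//.
rewrite l2norm_sq innerDl !innerDr sqrrD !l2norm_sq.
have := inner_cs x y; have := inner_cs y x.
have := cnormD (inner x x + inner x y) (inner y x + inner y y).
have := cnormD (inner x x) (inner x y); have := cnormD (inner y x) (inner y y).
rewrite (mulrC (l2norm y)); lra.
Qed.
Lemma l2normZ (c : R[i]) x : nrm (c *: x) = `|c| * nrm x.
Proof.
have -> : `|c| = (Normc.normc c)%:C by rewrite normc_def; case: c.
have c0 : 0 <= Normc.normc c by case: (c) => ? ?; exact: sqrtr_ge0.
have cc : Normc.normc (conjc c) = Normc.normc c by case: (c) => p q /=; rewrite sqrrN.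
rewrite /nrm -rmorphM /l2norm innerZr -inner_star innerZr starZ inner_star.
by rewrite !cnormZ cc mulrA -expr2 sqrtrM ?sqr_ge0// sqrtr_sqr ger0_norm.
Qed.
Lemma l2norm_eq0 x : nrm x = 0 -> x = 0.
Proof.
case=> h; apply: val_inj; apply/funext => n /=; apply: cnorm_eq0; apply/eqP.
rewrite -sqrf_eq0 -cnorm_star_mul eq_le cnorm_ge0 andbT.
have := partial_le x n.+1; rewrite -l2norm_sq h expr0n; apply: le_trans.
rewrite big_nat_recr//= addrC; apply: cnorm_mono; first exact: pos_star_mul.
by apply: pos_sum => i; exact: pos_star_mul.
Qed.
HB.instance Definition _ := Lmodule_isNormed.Build R[i] (l2 A) l2normD l2normZ l2norm_eq0.

Lemma l2_normE x : `|x| = (l2norm x)%:C.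
Proof. by []. Qed.
End NormedL2.

Section Fredholm.
Variables (R : realType) (A : cstarAlgType R).
Local Notation H := (l2 A).
Implicit Types (F G : H -> H) (M : set H).

Definition right_linear F :=
  (forall x y, F (x + y) = F x + F y) /\ (forall x a, F (ract x a) = ract (F x) a).

Definition bounded_on M F := exists k : R, forall x, M x -> `|F x| <= k%:C * `|x|.

Definition adjointable F := exists G, forall x y, inner (F x) y = inner x (G y).

(* The bounded adjointable A-linear operators, B^a(H_A). *)
Definition Ba : set (H -> H) :=
  [set F | [/\ right_linear F, bounded_on setT F & adjointable F]].

Definition closed_submodule M :=
  [/\ M 0, forall x y, M x -> M y -> M (x + y),
      forall x a, M x -> M (ract x a) & closed M].

Definition direct_sum (M N : set H) :=
  M `&` N = [set 0] /\ forall x, exists m n, [/\ M m, N n & x = m + n].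

(* The g i automatically belong to M. *)
Definition finitely_generated M :=
  exists (n : nat) (g : 'I_n -> H),
    M = [set x | exists a : 'I_n -> A, x = \sum_(i < n) ract (g i) (a i)].

(* F restricted to M1 is a bijection onto M2, bounded with bounded inverse;
   A-linearity is inherited from F. *)
Definition isomorphism_on F (M1 M2 : set H) :=
  [/\ set_bij M1 M2 F, bounded_on M1 F &
      exists k : R, forall x, M1 x -> `|x| <= k%:C * `|F x|].

Definition diag_decomposition F (M1 N1 M2 N2 : set H) :=
  [/\ [/\ closed_submodule M1, closed_submodule N1,
          closed_submodule M2 & closed_submodule N2],
      direct_sum M1 N1, direct_sum M2 N2 &
      [/\ F @` M1 `<=` M2, F @` N1 `<=` N2 & isomorphism_on F M1 M2]].

Definition MPhi : set (H -> H) :=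
  [set F | Ba F /\ exists M1 N1 M2 N2,
    [/\ diag_decomposition F M1 N1 M2 N2,
        finitely_generated N1 & finitely_generated N2]].
End Fredholm.

(* Main.v *)
Require Import Defs.
From mathcomp Require Import all_boot all_order all_algebra.
From mathcomp Require Import boolp classical_sets functions reals.
Import GRing.Theory.
Local Open Scope classical_set_scope.
Local Open Scope ring_scope.

(** The lemma is purely algebraic.  The two-term complex [F : H -> H] is homotopy
equivalent to [F : N1 -> N2], and, by the decomposition that makes [F] Fredholm, to
[F : N1' -> N2'].  Hence [N1] is a direct summand of [N2 (+) N1'], a finitely generated
module.

Explicitly, let [G] be the inverse of [F : M1' -> M2'], extended by zero on [N2'].
Then [x - G (F x)] is the [N1']-component of [x], for every [x].  Let [q] be the
projection onto [N1] along [M1].  If [x] lies in [N1], then [F x] lies in [N2] and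
<<
  x = q x = q (G (F x)) + q (x - G (F x)),
>>
so [N1 = q (G N2) + q N1'], a sum of two images of finitely generated modules under
[A]-linear maps.  Both [G] and [q] are provided by [inverse_along], and the closure
properties of finitely generated modules are [fg_image] and [fg_add]. *)

Section Algebra.
Set Implicit Arguments.
Unset Strict Implicit.
Variables (R : realType) (A : cstarAlgType R).
Local Notation H := (l2 A).
Implicit Types (x y : H) (a : A) (F : H -> H) (M N : set H).

Definition submodule M :=
  [/\ M 0, forall x y, M x -> M y -> M (x + y) & forall x a, M x -> M (ract x a)].

Lemma closed_submoduleW M : closed_submodule M -> submodule M.
Proof. by case. Qed.

Lemma ractN1 x : ract x (-1) = - x.
Proof. by apply: val_inj; apply/funext => n /=; rewrite mulrN1. Qed.

Lemma ractBl x y a : ract (x - y) a = ract x a - ract y a.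
Proof. by apply: val_inj; apply/funext => n /=; rewrite mulrBl. Qed.

Lemma submoduleB M x y : submodule M -> M x -> M y -> M (x - y).
Proof. by case=> _ MD Mr Mx My; apply: MD => //; rewrite -ractN1; exact: Mr. Qed.

Lemma right_linear0 F : right_linear F -> F 0 = 0.
Proof. by case=> FD _; apply: (addrI (F 0)); rewrite -FD !addr0. Qed.

Lemma right_linear_sum F (I : Type) (r : seq I) (f : I -> H) :
  right_linear F -> F (\sum_(i <- r) f i) = \sum_(i <- r) F (f i).
Proof.
by move=> Flin; apply: (big_morph F); [case: Flin|exact: right_linear0].
Qed.

Lemma direct_sumC M N : direct_sum M N -> direct_sum N M.
Proof.
case=> MN0 MN; split; first by rewrite setIC.
by move=> x; have [m [n [Mm Nn ->]]] := MN x; exists n, m; rewrite addrC.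
Qed.

(** [G] is the inverse of [F : M1 -> M2] extended by zero on [N2].  The last clause
characterises [G y] among the elements of [M1], and linearity follows from it.  With
[F := id] and [M1 = M2], [G] is the projection onto [M1] along [N2]. *)
Lemma inverse_along F (M1 M2 N2 : set H) :
  right_linear F -> submodule M1 -> submodule M2 -> submodule N2 ->
  direct_sum M2 N2 -> set_bij M1 M2 F ->
  exists G : H -> H, [/\ right_linear G, forall y, M1 (G y) &
    forall x y, M1 x -> N2 (y - F x) -> G y = x].
Proof.
move=> Flin M1s M2s N2s [MN0 MN] [Ffun Finj Fsurj].
have /choice[G Gprop] : forall y, exists x, M1 x /\ N2 (y - F x).
  move=> y; have [m [n [Mm Nn ->]]] := MN y.
  have [x M1x <-] := Fsurj _ Mm.
  by exists x; split=> //; rewrite addrC addKr.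
have M1G y : M1 (G y) by have [] := Gprop y.
have uniqG x y : M1 x -> N2 (y - F x) -> G y = x.
  move=> M1x N2x; have [_ N2G] := Gprop y.
  apply: Finj; rewrite ?inE//; apply/eqP; rewrite -subr_eq0; apply/eqP.
  suff : (M2 `&` N2) (F (G y) - F x) by rewrite MN0.
  split; first by apply: submoduleB => //; exact: Ffun.
  rewrite (_ : F (G y) - F x = (y - F x) - (y - F (G y))); first exact: submoduleB.
  by rewrite opprB [RHS]addrC addrA subrK.
have [FD FZ] := Flin; have [_ M1D M1Z] := M1s; have [_ N2D N2Z] := N2s.
exists G; split=> //; split=> [x y|x a]; apply: uniqG.
- exact: M1D.
- rewrite FD opprD addrACA; apply: N2D; [by have [] := Gprop x|by have [] := Gprop y].
- exact: M1Z.
- by rewrite FZ -ractBl; apply: N2Z; have [] := Gprop x.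
Qed.

Lemma fg_image F M :
  right_linear F -> finitely_generated M -> finitely_generated (F @` M).
Proof.
move=> Flin [n [g ->]]; exists n, (F \o g).
have Fcomb (c : 'I_n -> A) :
    F (\sum_(i < n) ract (g i) (c i)) = \sum_(i < n) ract (F (g i)) (c i).
  by rewrite right_linear_sum//; apply: eq_bigr => i _; case: Flin.
apply/seteqP; split=> [_ [_ [c ->] <-]|_ [c ->]]; first by exists c.
by exists (\sum_(i < n) ract (g i) (c i)) => //; exists c.
Qed.

Lemma fg_add M N : finitely_generated M -> finitely_generated N ->
  finitely_generated [set x + y | x in M & y in N].
Proof.
move=> [m [g ->]] [n [h ->]].
pose gh (i : 'I_(m + n)) := match fintype.split i with inl j => g j | inr k => h k end.
have ghl j : gh (lshift n j) = g j.
  by rewrite /gh -[lshift n j]/(unsplit (inl j)) unsplitK.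
have ghr k : gh (rshift m k) = h k.
  by rewrite /gh -[rshift m k]/(unsplit (inr k)) unsplitK.
exists (m + n)%N, gh; apply/seteqP; split=> [_ [_ [b ->] [_ [c ->] <-]]|_ [a ->]].
  exists (fun i => match fintype.split i with inl j => b j | inr k => c k end).
  rewrite big_split_ord /=; congr (_ + _); apply: eq_bigr => i _.
    by rewrite ghl -[lshift n i]/(unsplit (inl i)) unsplitK.
  by rewrite ghr -[rshift m i]/(unsplit (inr i)) unsplitK.
exists (\sum_(j < m) ract (g j) (a (lshift n j))); first by eexists.
exists (\sum_(k < n) ract (h k) (a (rshift m k))); first by eexists.
by rewrite big_split_ord /=; congr (_ + _); apply: eq_bigr => i _; rewrite (ghl, ghr).
Qed.

End Algebra.

Theorem lemma2p17 (R : realType) (A : cstarAlgType R) (F : l2 A -> l2 A)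
    (M1 N1 M2 N2 : set (l2 A)) :
  MPhi F ->
  diag_decomposition F M1 N1 M2 N2 ->
  finitely_generated N2 ->
  finitely_generated N1.
Proof.
move=> [[Flin _ _] [M1' [N1' [M2' [N2' [dec' fgN1' _]]]]]].
move=> [[/closed_submoduleW M1s /closed_submoduleW N1s _ _] MN1 _ [_ FN _]] fgN2.
have [[/closed_submoduleW M1s' _ /closed_submoduleW M2s' /closed_submoduleW N2s']] := dec'.
move=> [_ MN1'] MN2' [_ FN' [Fbij' _ _]].
have [G [Glin _ GE]] := inverse_along Flin M1s' M2s' N2s' MN2' Fbij'.
have idlin : right_linear (@id (l2 A)) by [].
have idbij : set_bij N1 N1 id by split=> // x N1x; exists x.
have [q [qlin N1q qE]] :=
  inverse_along idlin N1s N1s M1s (direct_sumC MN1) idbij.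
suff -> : N1 = [set u + v | u in q @` (G @` N2) & v in q @` N1'].
  by apply: fg_add; do ?apply: fg_image.
have [_ N1D _] := N1s.
apply/seteqP; split=> [x N1x|_ [_ [y _ <-] [_ [z _ <-] <-]]]; last exact: N1D.
have [m [n [M1m N1n xE]]] := MN1' x.
have GFx : G (F x) = m.
  apply: GE => //; rewrite xE; case: Flin => -> _.
  by rewrite addrC addKr; apply: FN'; exists n.
exists (q m); first by exists m => //; exists (F x) => //; apply: FN; exists x.
exists (q n); first by exists n.
have [qD _] := qlin; rewrite -qD -xE; apply: qE => //=.
by rewrite subrr; case: M1s.
Qed.
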